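(* Let $d\in\{2,3\}$, let $\mathcal{T}_h$ be a triangular ($d=2$) or tetrahedral ($d=3$) mesh of $\Omega\subset\mathbb{R}^d$, let $\lambda,\mu\in\mathbb{R}$ be constants with $\mu>0$ and $\lambda+\frac{2}{d}\mu>0$, let the elasticity tensor be isotropic and homogeneous, $$c_{pqrs}=\lambda\delta_{pq}\delta_{rs}+\mu(\delta_{pr}\delta_{qs}+\delta_{ps}\delta_{qr}),$$ and let $\nu:=\frac{\lambda}{2(\lambda+\mu)}$ be the Poisson ratio. Let $P_i,P_j\in\mathcal{N}_h$ be two nodal points such that $j\in\Lambda_i$ (equivalently $i\in\Lambda_j$) and $\{P_i,P_j\}\not\subset\Gamma$. Let $T_1,\dots,T_{\alpha_0}$ be the elements of $\mathcal{T}_h$ having both $P_i$ and $P_j$ as vertices, and for $\alpha\in\{1,\dots,\alpha_0\}$ let $\theta^\alpha$ be the (interior) angle of $T_\alpha$ if $d=2$, or (interior) dihedral angle of $T_\alpha$ if $d=3$, between $\partial_jT_\alpha$ and $\partial_iT_\alpha$. If $$\cos\theta^\alpha>\frac{1}{3-4\nu}\qquad\text{for all }\alpha\in\{1,\dots,\alpha_0\},$$ then the spring constant $K_{ij}$ is positive-definite.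
   Context: $\Omega\subset\mathbb{R}^d$ is a bounded Lipschitz domain whose boundary $\Gamma=\partial\Omega$ is polygonal ($d=2$) or polyhedral ($d=3$). $\mathcal{T}_h=\{T^\alpha\}_{\alpha=1}^{N_e}$ is a (conforming) triangulation of $\Omega$ into closed triangles ($d=2$) or closed tetrahedra ($d=3$), and $\mathcal{N}_h=\{P_j\}_{j=1}^{N_p}$ is its set of nodal points (vertices). $P_1(\mathcal{T}_h)$ is the space of functions in $C^0(\overline\Omega)$ whose restriction to each $T^\alpha$ is linear (affine), and $\varphi_1,\dots,\varphi_{N_p}$ is its nodal basis, $\varphi_j(P_i)=\delta_{ij}$. $e_1,\dots,e_d$ is the standard basis of $\mathbb{R}^d$. A subscript $,p$ denotes $\partial/\partial x_p$. For $u\in H^1(\Omega)^d$, the strain is $e_{pq}[u]=\frac12(u_{p,q}+u_{q,p})$ and the stress is $\sigma_{pq}[u]=\sum_{r,s=1}^d c_{pqrs}e_{rs}[u]$; the bilinear form is $a(u,v)=\int_\Omega \sum_{p,q}\sigma_{pq}[u]\,e_{pq}[v]\,dx$. The spring constants are the matrices $K_{ij}=(K_{ij}^{kl})_{k,l=1,\dots,d}\in\mathbb{R}^{d\times d}$, $K_{ij}^{kl}:=-a(\varphi_j e_l,\varphi_i e_k)$, for $i,j\in\{1,\dots,N_p\}$, and $\Lambda_i:=\{j\in\{1,\dots,N_p\}\setminus\{i\}:\ K_{ij}\neq O\}$. A matrix $K\in\mathbb{R}^{d\times d}$ is positive-definite if $(K\xi)\cdot\xi>0$ for all $\xi\in\mathbb{R}^d\setminus\{0\}$.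 Faces: let $D_{ij}$ be the intersection of the supports of $\varphi_i$ and $\varphi_j$, so that $\overline{D_{ij}}=\bigcup_{\alpha=1}^{\alpha_0}T_\alpha$. Put $\Gamma_l:=\{x\in\partial D_{ij}:\varphi_l(x)\neq0\}$ and $\partial_lT_\alpha:=\Gamma_l\cap\partial T_\alpha$ for $l\in\{i,j\}$. Thus, up to its relative boundary, $\partial_iT_\alpha$ is the edge ($d=2$) or face ($d=3$) of $T_\alpha$ opposite to $P_j$, and $\partial_jT_\alpha$ is the edge or face of $T_\alpha$ opposite to $P_i$; for $d=2$, $\theta^\alpha$ is the angle of the triangle $T_\alpha$ at its third vertex (the one other than $P_i,P_j$). *)

(* Defs.v *)
From HB Require Import structures.
From mathcomp Require Import all_boot all_order all_algebra.
From mathcomp Require Import all_classical all_reals all_analysis.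

Set Implicit Arguments.
Unset Strict Implicit.
Unset Printing Implicit Defensive.

Import Order.TTheory GRing.Theory Num.Theory.
Import numFieldNormedType.Exports.

Local Open Scope classical_set_scope.
Local Open Scope ring_scope.

(* Image of the product measure m1 \x m2 under (x, t) |-> x :: t. *)
Section cons_measure.
Context d (T : measurableType d) (R : realType) (n : nat).
Variable m1 : {sigma_finite_measure set T -> \bar R}.
Variable m2 : {sigma_finite_measure set (n.-tuple T) -> \bar R}.

Let cons_tup (z : T * n.-tuple T) : n.+1.-tuple T := [tuple of z.1 :: z.2].

Definition cons_measure : set (n.+1.-tuple T) -> \bar R :=
  pushforward (m1 \x m2)%E cons_tup.

Let measurable_cons_tup : measurable_fun [set: T * n.-tuple T] cons_tup.
Proof. exact: measurable_cons. Qed.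

Let measurable_preimage A : measurable A -> measurable (cons_tup @^-1` A).
Proof. by move=> mA; rewrite -[X in measurable X]setTI; exact: measurable_cons_tup. Qed.

Let cons_measure0 : cons_measure set0 = 0%E.
Proof. by rewrite /cons_measure /pushforward preimage_set0 measure0. Qed.

Let cons_measure_ge0 A : (0 <= cons_measure A)%E.
Proof. exact: measure_ge0. Qed.

Let cons_measure_sigma_additive : semi_sigma_additive cons_measure.
Proof.
move=> F mF tF mUF; rewrite /cons_measure /pushforward preimage_bigcup.
apply: measure_semi_sigma_additive.
- by move=> k; exact: measurable_preimage.
- apply/trivIsetP => /= i j _ _ ij; rewrite -preimage_setI.
  by move/trivIsetP : tF => /(_ _ _ _ _ ij) ->//; rewrite preimage_set0.
- by rewrite -preimage_bigcup; exact: measurable_preimage.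
Qed.

HB.instance Definition _ := isMeasure.Build _ _ _ cons_measure
  cons_measure0 cons_measure_ge0 cons_measure_sigma_additive.

(* m1 \x m2 is sigma-finite, but its sigma-finite instance is not inferable. *)
Let cons_measure_sigma_finite : sigma_finite setT cons_measure.
Proof.
have /sigma_finiteP[F [TF ndF Foo]] := sigma_finiteT m1.
have /sigma_finiteP[G [TG ndG Goo]] := sigma_finiteT m2.
pose g (t : n.+1.-tuple T) := (thead t, [tuple of behead t]).
have mg : measurable_fun [set: _] g.
  apply: measurable_fun_pair => /=; first exact: measurable_tnth.
  exact: measurable_behead.
have gK : g \o cons_tup = id.
  apply/funext => -[x t]; rewrite /g /cons_tup /= theadE.
  by congr pair; exact: val_inj.
exists (fun k => g @^-1` (F k `*` G k)).
  rewrite -preimage_bigcup -[LHS](preimage_setT g); congr (_ @^-1` _).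
  rewrite -setXTT TF TG predeqE => -[x y]; split.
    move=> [/= [k _ Fkx] [l _ Gly]]; exists (maxn k l) => //; split.
    - by move: x Fkx; exact/subsetPset/ndF/leq_maxl.
    - by move: y Gly; exact/subsetPset/ndG/leq_maxr.
  by move=> [k _ []/= ? ?]; split; exists k.
move=> k; have [mFk Fk] := Foo k; have [mGk Gk] := Goo k; split.
  by rewrite -[X in measurable X]setTI; apply: mg => //; exact: measurableX.
rewrite /cons_measure /pushforward -comp_preimage gK preimage_id.
by rewrite product_measure1E// lte_mul_pinfty// ge0_fin_numE.
Qed.

HB.instance Definition _ := Measure_isSigmaFinite.Build _ _ _ cons_measure
  cons_measure_sigma_finite.

End cons_measure.

(* Lebesgue measure on R^n, carried by [n.-tuple R] with its product
   sigma-algebra. *)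
Fixpoint lebesgue_tuple (R : realType) (n : nat) :
    {sigma_finite_measure set (n.-tuple (measurableTypeR R)) -> \bar R} :=
  if n is n'.+1 then cons_measure lebesgue_measure (lebesgue_tuple R n')
  else dirac [tuple].

Section geometry.
Context {R : realType} {d : nat}.
Implicit Types (A B Omega : set 'rV[R]_d) (u v x y : 'rV[R]_d).

Definition dot u v : R := \sum_k u 0 k * v 0 k.

Definition enorm u : R := Num.sqrt (dot u u).

Definition vangle u v : R := acos (dot u v / (enorm u * enorm v)).

Definition boundary A : set 'rV[R]_d := closure A `\` interior A.

(* Convex hull of the points P k, k in S. *)
Definition hull (I : finType) (P : I -> 'rV[R]_d) (S : {set I}) :
    set 'rV[R]_d :=
  [set x | exists w : I -> R,
    [/\ forall k, 0 <= w k, forall k, k \notin S -> w k = 0,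
        \sum_k w k = 1 & x = \sum_k w k *: P k]].

Definition affinely_independent (I : finType) (P : I -> 'rV[R]_d)
    (S : {set I}) : Prop :=
  forall w : I -> R, (forall k, k \notin S -> w k = 0) ->
    \sum_k w k = 0 -> \sum_k w k *: P k = 0 -> forall k, w k = 0.

(* Near each boundary point, Omega is the strict epigraph of a Lipschitz
   function in the direction of some unit vector n; y - (y . n) n is the
   orthogonal projection of y on the hyperplane orthogonal to n. *)
Definition lipschitz_boundary Omega : Prop :=
  forall x, boundary Omega x ->
    exists (n : 'rV[R]_d) (g : 'rV[R]_d -> R) (L : R) (U : set 'rV[R]_d),
      [/\ dot n n = 1,
          forall y z, `|g y - g z| <= L * enorm (y - z),
          open U, U x &
          forall y, U y -> (Omega y <-> g (y - dot y n *: n) < dot y n)].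

(* The boundary is a finite union of (d-1)-simplices: segments for d = 2,
   triangles for d = 3. *)
Definition polyhedral_boundary Omega : Prop :=
  exists (m : nat) (Q : 'I_m -> 'I_d -> 'rV[R]_d),
    (forall k, affinely_independent (Q k) [set: 'I_d]%SET) /\
    boundary Omega = \bigcup_k hull (Q k) [set: 'I_d]%SET.

Record polyhedral_lipschitz_domain Omega : Prop := {
  dom_open : open Omega;
  dom_connected : connected Omega;
  dom_nonempty : Omega !=set0;
  dom_bounded : bounded_set Omega;
  dom_lipschitz : lipschitz_boundary Omega;
  dom_polyhedral : polyhedral_boundary Omega }.

(* Plane angle of two faces A and B of a simplex meeting in A `&` B: from a
   common point y, u points into A and v into B, both orthogonally to A `&` B.
   For d = 2 the set A `&` B is a point and this is the angle at that vertex;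
   for d = 3 it is an edge and this is the dihedral angle there. *)
Definition interior_angle A B (theta : R) : Prop :=
  exists y u v,
    [/\ (A `&` B) y,
        u != 0 /\ v != 0,
        A (y + u) /\ B (y + v),
        forall z z', (A `&` B) z -> (A `&` B) z' ->
          dot (z - z') u = 0 /\ dot (z - z') v = 0 &
        theta = vangle u v].

End geometry.

Section finite_elements.
Context {R : realType} {d Np Ne : nat}.
Variables (Omega : set 'rV[R]_d) (P : 'I_Np -> 'rV[R]_d).
Variables (T : 'I_Ne -> {set 'I_Np}).

(* T alpha is the set of indices of the vertices of the element alpha. *)
Definition element (alpha : 'I_Ne) : set 'rV[R]_d := hull P (T alpha).

Record triangulation : Prop := {
  mesh_node_inj : injective P;
  mesh_elt_inj : injective T;
  mesh_simplex : forall alpha, #|T alpha| = d.+1;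
  mesh_nondegenerate : forall alpha, affinely_independent P (T alpha);
  mesh_node_used : forall k, exists alpha, k \in T alpha;
  mesh_cover : closure Omega = \bigcup_alpha element alpha;
  mesh_conforming : forall alpha beta,
    element alpha `&` element beta = hull P (T alpha :&: T beta)%SET }.

(* Functions on the closure of Omega are represented by functions on R^d,
   whose values elsewhere are irrelevant. *)
Definition P1 (f : 'rV[R]_d -> R) : Prop :=
  {within closure Omega, continuous f} /\
  forall alpha, exists (g : 'rV[R]_d) (b : R),
    forall x, element alpha x -> f x = dot g x + b.

Variable phi : 'I_Np -> 'rV[R]_d -> R.

Definition nodal_basis : Prop :=
  forall j, P1 (phi j) /\ forall i, phi j (P i) = (i == j)%:R.

(* Supports are the sets where the functions do not vanish: with closed
   supports the intersection could contain lower-dimensional pieces outside the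
   elements that have both P i and P j as vertices. *)
Definition overlap (i j : 'I_Np) : set 'rV[R]_d :=
  [set x | [/\ closure Omega x, phi i x != 0 & phi j x != 0]].

Definition overlap_boundary (i j l : 'I_Np) : set 'rV[R]_d :=
  [set x | boundary (overlap i j) x /\ phi l x != 0].

(* For l = i (resp. l = j) this is, up to its relative boundary, the face of
   the element alpha opposite to P j (resp. P i). *)
Definition element_face (i j l : 'I_Np) (alpha : 'I_Ne) : set 'rV[R]_d :=
  overlap_boundary i j l `&` boundary (element alpha).

End finite_elements.

Section elasticity.
Context {R : realType} {d : nat}.
Implicit Types (u v : 'rV[R]_d -> 'rV[R]_d) (x : 'rV[R]_d) (p q r s : 'I_d).
Variable Omega : set 'rV[R]_d.

Definition elasticity_tensor := 'I_d -> 'I_d -> 'I_d -> 'I_d -> R.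

Definition isotropic (lambda mu : R) : elasticity_tensor := fun p q r s =>
  lambda * ((p == q)%:R * (r == s)%:R) +
  mu * ((p == r)%:R * (q == s)%:R + (p == s)%:R * (q == r)%:R).

(* Derivatives are the pointwise ones.  For the piecewise affine fields
   considered here they exist off the boundaries of the elements, a null set,
   and coincide there with the weak derivatives. *)
Definition partial q (f : 'rV[R]_d -> R) x : R := 'D_(delta_mx 0 q) f x.

Definition strain u p q x : R :=
  2^-1 * (partial q (fun y => u y 0 p) x + partial p (fun y => u y 0 q) x).

Definition stress (c : elasticity_tensor) u p q x : R :=
  \sum_r \sum_s c p q r s * strain u r s x.

Definition row_of (t : d.-tuple (measurableTypeR R)) : 'rV[R]_d :=
  \row_k (tnth t k : R).

Definition elastic_form (c : elasticity_tensor) u v : R :=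
  \int[lebesgue_tuple R d]_(t in row_of @^-1` Omega)
    (\sum_p \sum_q stress c u p q (row_of t) * strain v p q (row_of t)).

Context {Np : nat}.
Variable phi : 'I_Np -> 'rV[R]_d -> R.

Definition spring (c : elasticity_tensor) (i j : 'I_Np) : 'M[R]_d :=
  \matrix_(k, l) - elastic_form c (fun x => phi j x *: delta_mx 0 l)
                                  (fun x => phi i x *: delta_mx 0 k).

Definition spring_neighbours (c : elasticity_tensor) (i : 'I_Np) :
    {set 'I_Np} :=
  [set j | (j != i) && (spring c i j != 0)]%SET.

Definition posdefmx (K : 'M[R]_d) : Prop :=
  forall xi : 'cV[R]_d, xi != 0 -> 0 < \sum_k (K *m xi) k 0 * xi k 0.

End elasticity.

(* Main.v *)
Require Import Defs.
From HB Require Import structures.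
From mathcomp Require Import all_boot all_order all_algebra.
From mathcomp Require Import all_classical all_reals all_analysis.
From mathcomp Require Import measurable_realfun.
From mathcomp Require Import ring lra zify.

Set Implicit Arguments.
Unset Strict Implicit.
Unset Printing Implicit Defensive.

Import Order.TTheory GRing.Theory Num.Theory.
Import numFieldNormedType.Exports.

Local Open Scope classical_set_scope.
Local Open Scope ring_scope.

(* On each element the nodal functions are affine, with gradients g_k, so off a
   null set the integrand of a(phi_j e_l, phi_i e_k) is constant on elements and

     (K_ij xi).xi = - sum_T |T| ((lambda + mu)(g_i.xi)(g_j.xi) + mu (g_i.g_j)|xi|^2)

   over the elements T with vertices P_i and P_j.  Since g_i and g_j are normal
   to the faces opposite to P_i and P_j, g_i.g_j = - |g_i||g_j| cos theta, and
   2(g_i.xi)(g_j.xi) <= (g_i.g_j + |g_i||g_j|)|xi|^2.  Each summand is thus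
   negative as soon as cos theta > (lambda + mu)/(lambda + 3 mu) = 1/(3 - 4 nu),
   and the sum is nonempty because K_ij <> 0.

   That one of P_i, P_j is not on Gamma ensures that the faces containing the
   edge P_i P_j are not in the boundary of the overlap, so that the two sets
   whose angle is theta really are the faces opposite to P_i and P_j. *)

(** * Integration off null sets, Lebesgue measure on tuples *)

Section null_sets.
Local Open Scope ereal_scope.
Context d (T : measurableType d) (R : realType).
Variable mu : {measure set T -> \bar R}.
Import HBNNSimple.

(** The integral of [f] is a supremum over simple functions below [f]. Setting such a function to 0
    on [N] keeps its integral and puts it below [g]. *)
Let le_integral_off_null (N : set T) (f g : T -> \bar R) :
  measurable N -> mu N = 0 ->
  (forall x, 0 <= f x) -> (forall x, 0 <= g x) ->
  (forall x, ~ N x -> f x = g x) -> \int[mu]_x f x <= \int[mu]_x g x.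
Proof.
move=> mN N0 f0 g0 fg; rewrite [leLHS]ge0_integralTE// [leRHS]ge0_integralTE//.
apply: ge_ereal_sup => _ [h hf <-].
pose h' := proj_nnsfun h (measurableC mN).
have h'E x : h' x = if x \in N then 0%R else h x.
  rewrite /h' -mrestrict patchE in_setC; by case: (x \in N).
apply: ereal_sup_ubound; exists h'.
  move=> x; change ((h' x)%:E <= g x); rewrite h'E; case: ifPn => [_//|xN].
  by rewrite -fg ?hf// => Nx; move: xN; rewrite mem_set.
have sE (k : {nnsfun T >-> R}) : sintegral mu k = \int[mu]_x (k x)%:E.
  by rewrite integral_nnsfun// patch_setT.
rewrite !sE; apply: ae_eq_integral => //.
- exact/measurable_EFinP/measurable_funP.
- exact/measurable_EFinP/measurable_funP.
- exists N; split => // x nfg; apply: contrapT => Nx; apply: nfg => _.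
  by congr EFin; rewrite h'E memNset.
Qed.

(* Stated for arbitrary functions, because the integrand of [elastic_form] has
   junk values where the nodal functions are not differentiable. *)
Lemma eq_integral_off_null (N : set T) (f g : T -> \bar R) :
  measurable N -> mu N = 0 -> (forall x, ~ N x -> f x = g x) ->
  \int[mu]_x f x = \int[mu]_x g x.
Proof.
move=> mN N0 fg; rewrite [LHS]integralE [RHS]integralE.
congr (_ - _); apply/eqP; rewrite eq_le; apply/andP; split;
  apply: (le_integral_off_null mN N0) => // x Nx;
  by rewrite ?funeposE ?funenegE fg.
Qed.

End null_sets.

Section lebesgue_tuple.
Context {R : realType}.
Local Notation "'leb' n" := (lebesgue_tuple R n) (at level 10).

Lemma measurable_affine d (g : 'rV[R]_d) (b : R) :
  measurable_fun [set: d.-tuple (measurableTypeR R)]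
    (fun t => dot g (row_of t) + b : measurableTypeR R).
Proof.
apply: measurable_funD => //; rewrite /dot.
apply: measurable_sum => k; apply: measurable_funM => //.
under eq_fun do rewrite mxE.
exact: measurable_tnth.
Qed.

Definition hyperplane d (g : 'rV[R]_d) (b : R) : set 'rV[R]_d :=
  [set x | dot g x + b = 0].

Lemma measurable_hyperplane d (g : 'rV[R]_d) (b : R) :
  measurable (@row_of R d @^-1` hyperplane g b).
Proof.
rewrite -[X in measurable X]setTI.
exact: (measurable_affine g b measurableT (measurable_set1 (0 : R))).
Qed.

Lemma lebesgue_tupleS n (A : set (n.+1.-tuple (measurableTypeR R))) :
  leb n.+1 A = (\int[lebesgue_measure]_x
     leb n [set t | A (cons_tuple (x : measurableTypeR R) t)])%E.
Proof.
rewrite /= /cons_measure /pushforward /product_measure1.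
apply: eq_integral => x _ /=; congr (leb n _).
by apply/seteqP; split => t; rewrite /xsection /= inE.
Qed.

(** Induction on the dimension, slicing along the first coordinate. If the tail [g'] of the normal
    is nonzero, every slice is a null hyperplane; otherwise every slice is empty except the one over
    the single point [- b / g 0 ord0]. *)
Lemma hyperplane_null d (g : 'rV[R]_d) (b : R) :
  g != 0 -> leb d (@row_of R d @^-1` hyperplane g b) = 0%E.
Proof.
elim: d g b => [|n IH] g b; first by rewrite thinmx0 eqxx.
pose g' : 'rV[R]_n := \row_k g 0 (lift ord0 k).
have gE x t : dot g (row_of (cons_tuple x t)) = g 0 ord0 * x + dot g' (row_of t).
  rewrite /dot big_ord_recl !mxE tnth0; congr (_ + _).
  by apply: eq_bigr => k _; rewrite !mxE tnthS.
move=> g0; rewrite lebesgue_tupleS.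
have [g'0|g'0] := eqVneq g' 0; last first.
  rewrite integral0_eq// => x _; rewrite -(IH g' (g 0 ord0 * x + b) g'0).
  congr (leb n _); apply/seteqP; split => t /=; rewrite /hyperplane /= gE;
    by move=> <-; rewrite addrCA addrA.
have g00 : g 0 ord0 != 0.
  apply: contra g0 => /eqP g00; apply/eqP/rowP => k; rewrite mxE.
  case: (unliftP ord0 k) => [l|] -> //.
  by move/rowP : g'0 => /(_ l); rewrite !mxE.
transitivity (\int[lebesgue_measure]_(x in [set: measurableTypeR R]) 0%:E)%E;
  last by rewrite integral0.
apply: (@eq_integral_off_null _ (measurableTypeR R) _ _
  [set - b / g 0 ord0]) => //.
- exact: lebesgue_measure_set1.
- move=> x /= xb; rewrite (_ : mkset _ = set0) ?measure0//.
  apply/seteqP; split => t //=; rewrite /hyperplane /= gE g'0.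
  rewrite {1}/dot big1 ?addr0 => [|k _]; last by rewrite mxE mul0r.
  move/eqP; rewrite addr_eq0 => /eqP H; apply: xb.
  by rewrite -H mulrC mulKf.
Qed.

Lemma measurable_halfspace d (g : 'rV[R]_d) (b : R) :
  measurable (@row_of R d @^-1` [set x | 0 <= dot g x + b]).
Proof.
rewrite -[X in measurable X]setTI.
have := measurable_affine g b measurableT (measurable_itv `[(0 : R), +oo[).
by congr measurable; apply/seteqP; split => t /=; rewrite in_itv /= andbT.
Qed.

(** [A] lies in the cube [box d], whose measure is finite by induction as a product of interval
    lengths. *)
Lemma lebesgue_tuple_bounded d (A : set 'rV[R]_d) (B : R) :
  measurable (@row_of R d @^-1` A) -> (forall x k, A x -> `|x 0 k| <= B) ->
  (leb d (@row_of R d @^-1` A) < +oo)%E.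
Proof.
pose box n : set (n.-tuple (measurableTypeR R)) :=
  [set t | forall k, `[- B, B]%classic (tnth t k)].
have mbox n : measurable (box n).
  have -> : box n = \bigcap_(k in [set: 'I_n])
      (@tnth n (measurableTypeR R) ^~ k @^-1` `[- B, B]%classic).
    by apply/seteqP; split => t /= h k; [move=> _|]; exact: h.
  apply: fin_bigcap_measurable => // k _; rewrite -[X in measurable X]setTI.
  exact: (measurable_tnth k measurableT (measurable_itv `[- B, B])).
have box_lty n : (leb n (box n) < +oo)%E.
  elim: n => [|n IH]; first by rewrite /= diracE ltry.
  have -> : leb n.+1 (box n.+1) =
      (lebesgue_measure \x leb n)%E (`[- B, B]%classic `*` box n).
    rewrite /= /cons_measure /pushforward; congr (product_measure1 _ _ _).
    apply/seteqP; split => -[x t] /=.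
      move=> h; split; first by have := h ord0; rewrite tnth0.
      by move=> k; have := h (lift ord0 k); rewrite tnthS.
    by move=> [hx ht] k; case: (unliftP ord0 k) => [l|] ->; rewrite ?tnthS ?tnth0.
  rewrite product_measure1E//; last exact: mbox.
  apply: lte_mul_pinfty => //.
  change (lebesgue_measure `[- B, B]%classic \is a fin_num).
  by rewrite lebesgue_measure_itv /=; case: ifP.
move=> mA AB; apply: le_lt_trans (box_lty d).
apply: le_measure; rewrite ?inE//; first exact: mbox.
by move=> t At k /=; have := AB _ k At; rewrite mxE in_itv /= ler_norml.
Qed.

End lebesgue_tuple.

Lemma Rintegral_piecewise_const d (T : measurableType d) (R : realType)
    (mu : {measure set T -> \bar R}) (I : finType) (A : I -> set T) (c : I -> R)
    (D N : set T) (f : T -> R) :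
  measurable N -> mu N = 0%E ->
  (forall i, measurable (A i)) -> (forall i, (mu (A i) < +oo)%E) ->
  (forall x, ~ N x -> (f \_ D) x = \sum_i c i * \1_(A i) x) ->
  \int[mu]_(x in D) f x = \sum_i c i * fine (mu (A i)).
Proof.
move=> mN N0 mA Afin fE; rewrite Rintegral_mkcond /Rintegral.
rewrite (eq_integral_off_null (g := fun x => (\sum_i c i * \1_(A i) x)%:E) mN)//;
  last by move=> x Nx; rewrite fE.
have intA i : mu.-integrable [set: T] (fun x => (\1_(A i) x)%:E).
  apply/integrableP; split; first exact/measurable_EFinP.
  rewrite (eq_integral (fun x => (\1_(A i) x)%:E)); last first.
    by move=> t _; rewrite gee0_abs// lee_fin.
  by rewrite integral_indic// setIT.
under eq_integral do rewrite -sumEFin.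
rewrite integral_sum//; last first.
  move=> i; under eq_fun do rewrite EFinM.
  exact: integrableZl.
rewrite (eq_bigr (fun i => (c i * fine (mu (A i)))%:E)).
  by rewrite sumEFin.
move=> i _; under eq_integral do rewrite EFinM.
rewrite integralZl// integral_indic// setIT EFinM fineK//.
by rewrite ge0_fin_numE.
Qed.

(** * Angles of planes and their normals *)

Section dot.
Context {R : realType} {d : nat}.
Implicit Types (u v w : 'rV[R]_d) (a : R).

Lemma dotC u v : dot u v = dot v u.
Proof. by apply: eq_bigr => k _; rewrite mulrC. Qed.

Lemma dotDr u v w : dot u (v + w) = dot u v + dot u w.
Proof. by rewrite -big_split; apply: eq_bigr => k _; rewrite mxE mulrDr. Qed.

Lemma dotZr a u v : dot u (a *: v) = a * dot u v.
Proof. by rewrite mulr_sumr; apply: eq_bigr => k _; rewrite mxE mulrCA. Qed.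

Lemma dotNr u v : dot u (- v) = - dot u v.
Proof. by rewrite -scaleN1r dotZr mulN1r. Qed.

Lemma dotBr u v w : dot u (v - w) = dot u v - dot u w.
Proof. by rewrite dotDr dotNr. Qed.

Lemma dotDl u v w : dot (v + w) u = dot v u + dot w u.
Proof. by rewrite ![dot _ u]dotC dotDr. Qed.

Lemma dotZl a u v : dot (a *: v) u = a * dot v u.
Proof. by rewrite ![dot _ u]dotC dotZr. Qed.

Lemma dotNl u v : dot (- v) u = - dot v u.
Proof. by rewrite ![dot _ u]dotC dotNr. Qed.

Lemma dotBl u v w : dot (v - w) u = dot v u - dot w u.
Proof. by rewrite dotDl dotNl. Qed.

Definition dotE := (dotDl, dotDr, dotNl, dotNr, dotZl, dotZr).

Lemma dot0r u : dot u 0 = 0.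
Proof. by rewrite -(scale0r 0) dotZr mul0r. Qed.

Lemma dot0l u : dot 0 u = 0.
Proof. by rewrite dotC dot0r. Qed.

Lemma dot_sumr (I : finType) u (F : I -> 'rV[R]_d) :
  dot u (\sum_i F i) = \sum_i dot u (F i).
Proof. by apply: (big_morph (dot u)) => [v w|]; rewrite ?dotDr ?dot0r. Qed.

Lemma dot_delta u k : dot u (delta_mx 0 k) = u 0 k.
Proof.
rewrite /dot (bigD1 k)//= mxE !eqxx mulr1 big1 ?addr0// => l /negbTE lk.
by rewrite mxE lk andbF mulr0.
Qed.

Lemma dot_ge0 u : 0 <= dot u u.
Proof. by apply: sumr_ge0 => k _; rewrite -expr2 sqr_ge0. Qed.

Lemma dot_eq0 u : (dot u u == 0) = (u == 0).
Proof.
apply/idP/eqP => [|->]; last by rewrite dot0r.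
rewrite psumr_eq0 => [/allP u0|k _]; last by rewrite -expr2 sqr_ge0.
apply/rowP => k; rewrite mxE; apply/eqP.
by have := u0 k (mem_index_enum k); rewrite mulf_eq0 orbb.
Qed.

Lemma dot_gt0 u : u != 0 -> 0 < dot u u.
Proof. by move=> u0; rewrite lt_def dot_ge0 dot_eq0 u0. Qed.

Lemma cauchy_schwarz u v : dot u v ^+ 2 <= dot u u * dot v v.
Proof.
have [->|v0] := eqVneq v 0; first by rewrite !dot0r expr0n mulr0.
have := dot_ge0 (dot v v *: u - dot u v *: v).
rewrite !dotE [dot v u]dotC => h.
rewrite -(ler_pM2l (dot_gt0 v0)); lra.
Qed.

Lemma sqr_enorm u : enorm u ^+ 2 = dot u u.
Proof. by rewrite sqr_sqrtr// dot_ge0. Qed.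

Lemma enorm_gt0 u : u != 0 -> 0 < enorm u.
Proof. by move=> u0; rewrite sqrtr_gt0 dot_gt0. Qed.

Lemma enormZ a u : 0 <= a -> enorm (a *: u) = a * enorm u.
Proof.
by move=> a0; rewrite /enorm !dotE mulrA -expr2 sqrtrM ?sqr_ge0// sqrtr_sqr ger0_norm.
Qed.

Lemma cos_vangle u v : u != 0 -> v != 0 ->
  cos (vangle u v) = dot u v / (enorm u * enorm v).
Proof.
move=> u0 v0; have uv0 : 0 < enorm u * enorm v by rewrite mulr_gt0 ?enorm_gt0.
rewrite /vangle acosK// in_itv /= -ler_norml normrM normfV (gtr0_norm uv0).
rewrite ler_pdivrMr// mul1r -ler_sqr ?nnegrE ?normr_ge0 ?(ltW uv0)//.
by rewrite real_normK ?num_real// exprMn !sqr_enorm cauchy_schwarz.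
Qed.

(* [dot a a *: b - dot a b *: a] is |a|^2 times the component of [b] orthogonal
   to [a]. *)
Lemma in_plane_multiple (a b u : 'rV[R]_d) :
  0 < dot a a * dot b b - dot a b ^+ 2 ->
  dot a u = 0 -> 0 <= dot b u -> u != 0 ->
  (forall w, dot a w = 0 -> dot b w = 0 -> dot w u = 0) ->
  exists2 s, 0 < s & u = s *: (dot a a *: b - dot a b *: a).
Proof.
set D := _ - _ => D0 au bu u0 perp.
set p := _ *: b - _ *: a.
have ap : dot a p = 0 by rewrite !dotE; ring.
have bp : dot b p = D by rewrite !dotE [dot b a]dotC /D; ring.
(* [w] is [u] minus its projection on [p]. It is orthogonal to [a] and [b], hence to [p], and by
   [perp] also to [u]; so it is orthogonal to itself. *)
pose w := u - (dot b u / D) *: p.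
have aw : dot a w = 0 by rewrite /w dotBr dotZr ap au mulr0 subr0.
have bw : dot b w = 0 by rewrite /w dotBr dotZr bp divfK ?subrr// gt_eqF.
have w0 : w = 0.
  apply/eqP; rewrite -dot_eq0 {2}/w dotBr dotZr perp// {1}/p dotBr !dotZr.
  by rewrite ![dot w _]dotC aw bw !mulr0 subr0 mulr0 subr0.
exists (dot b u / D); last by apply/eqP; rewrite -subr_eq0 -/w w0.
rewrite divr_gt0// lt_def bu andbT; apply: contra u0 => /eqP bu0.
by move/eqP: w0; rewrite /w bu0 mul0r scale0r subr0.
Qed.

(** [u] is a positive multiple of the component of [b] orthogonal to [a], and [v] of the component
    of [a] orthogonal to [b]. The angle of these components is supplementary to that of [a] and [b],
    whence the minus sign. *)
Lemma cos_vangle_normals (a b u v : 'rV[R]_d) :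
  0 < dot a a * dot b b - dot a b ^+ 2 ->
  u != 0 -> dot a u = 0 -> 0 <= dot b u ->
  v != 0 -> dot b v = 0 -> 0 <= dot a v ->
  (forall w, dot a w = 0 -> dot b w = 0 -> dot w u = 0 /\ dot w v = 0) ->
  dot a b = - (enorm a * enorm b * cos (vangle u v)).
Proof.
move=> D0 u0 au bu v0 bv av perp; rewrite cos_vangle//.
have [|s s0 uE] := in_plane_multiple D0 au bu u0.
  by move=> w aw bw; have [] := perp w aw bw.
have D0' : 0 < dot b b * dot a a - dot b a ^+ 2 by rewrite mulrC [dot b a]dotC.
have [|t t0 vE] := in_plane_multiple D0' bv av v0.
  by move=> w bw aw; have [] := perp w aw bw.
have aN0 : a != 0.
  by apply/eqP => a0; move: D0; rewrite a0 !dot0l mul0r expr0n subrr ltxx.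
have bN0 : b != 0.
  by apply/eqP => b0; move: D0; rewrite b0 !dot0r mulr0 expr0n subrr ltxx.
(* With the Gram determinant [D], the unscaled components have norms |a| sqrt D and |b| sqrt D and
   inner product - (a.b) D, so [s], [t] and [D] cancel in the cosine. *)
pose D := dot a a * dot b b - dot a b ^+ 2.
have enu : enorm u = s * (enorm a * Num.sqrt D).
  rewrite uE enormZ ?ltW//; congr (_ * _).
  rewrite /enorm -sqrtrM ?dot_ge0//; congr Num.sqrt.
  by rewrite !dotE [dot b a]dotC /D; ring.
have env : enorm v = t * (enorm b * Num.sqrt D).
  rewrite vE enormZ ?ltW//; congr (_ * _).
  rewrite /enorm -sqrtrM ?dot_ge0//; congr Num.sqrt.
  by rewrite !dotE [dot b a]dotC /D; ring.
have uv : dot u v = - (s * t * dot a b * Num.sqrt D ^+ 2).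
  by rewrite sqr_sqrtr ?ltW// uE vE !dotE [dot b a]dotC /D; ring.
rewrite enu env uv; field.
by rewrite !gt_eqF ?enorm_gt0 ?sqrtr_gt0.
Qed.

(* Two unit vectors n, m satisfy 4 (n.x)(m.x) <= ((n+m).x)^2 <= |n+m|^2 |x|^2. *)
Lemma dot_prod_le (a b x : 'rV[R]_d) : a != 0 -> b != 0 ->
  2 * (dot a x * dot b x) <= (dot a b + enorm a * enorm b) * dot x x.
Proof.
move=> a0 b0; have := cauchy_schwarz (enorm b *: a + enorm a *: b) x.
have := sqr_ge0 (enorm b * dot a x - enorm a * dot b x).
rewrite !dotE [dot b a]dotC -!sqr_enorm => h1 h2.
have ea := enorm_gt0 a0; have eb := enorm_gt0 b0.
have e0 : 0 < 2 * (enorm a * enorm b) by rewrite !mulr_gt0.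
rewrite -(ler_pM2l e0); nra.
Qed.

(** Bounding the product by [dot_prod_le] leaves at most |a||b||x|^2 / 2 times (lambda + mu) - c
    (lambda + 3 mu), and the hypothesis on [c] makes this factor negative. *)
Lemma isotropic_form_neg (a b x : 'rV[R]_d) (lambda mu c : R) :
  0 < mu -> 0 < lambda + mu -> a != 0 -> b != 0 -> x != 0 ->
  dot a b = - (enorm a * enorm b * c) ->
  1 / (3 - 4 * (lambda / (2 * (lambda + mu)))) < c ->
  (lambda + mu) * (dot a x * dot b x) + mu * dot a b * dot x x < 0.
Proof.
move=> mu0 lm0 a0 b0 x0 abE.
have -> : 1 / (3 - 4 * (lambda / (2 * (lambda + mu)))) =
    (lambda + mu) / (lambda + 3 * mu).
  have lm3 : 0 < lambda + 3 * mu by lra.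
  by field; rewrite !gt_eqF//; lra.
rewrite ltr_pdivrMr; last by lra.
move=> cE; have := dot_prod_le x a0 b0; rewrite abE.
have := enorm_gt0 a0; have := enorm_gt0 b0; have := dot_gt0 x0.
set X := dot x x; set A := enorm a; set B := enorm b; set y := _ * dot b x.
move=> X0 B0 A0 yle.
have N0 : 0 < A * B * X by rewrite !mulr_gt0.
have h1 : (lambda + mu) * (2 * y) <= (lambda + mu) * ((- (A * B * c) + A * B) * X).
  by rewrite ler_pM2l.
have h2 : A * B * X * (lambda + mu) < A * B * X * (c * (lambda + 3 * mu)).
  by rewrite ltr_pM2l.
lra.
Qed.

End dot.

(** * Barycentric coordinates *)

Section simplex.
Context {R : realType} {d : nat} {I : finType}.
Implicit Types (P G : I -> 'rV[R]_d) (B : I -> R) (S : {set I}).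

(** The matrix with rows (P k, 1), k in [S], is square of size d + 1. Affine independence makes it
    row-free, hence row-full, so (x, 1) is a combination of its rows. *)
Lemma simplex_span P S x : #|S| = d.+1 -> affinely_independent P S ->
  exists w : I -> R, [/\ forall k, k \notin S -> w k = 0,
    \sum_k w k = 1 & x = \sum_k w k *: P k].
Proof.
move=> cardS indep.
pose M : 'M[R]_(#|S|, d + 1) :=
  row_mx (\matrix_(m < #|S|) P (enum_val m)) (const_mx 1).
(* Extension by zero from the enumeration of [S] to all of [I]. *)
pose ext (v : 'rV[R]_#|S|) k := \sum_(m < #|S| | enum_val m == k) v 0 m.
have ext_out v k : k \notin S -> ext v k = 0.
  move=> kS; rewrite /ext big_pred0// => m; apply/eqP => mk.
  by move: kS; rewrite -mk enum_valP.
have ext_in v m : ext v (enum_val m) = v 0 m.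
  by rewrite /ext (big_pred1 m)// => l; rewrite (inj_eq enum_val_inj).
have ext_sum v : \sum_k ext v k = (v *m const_mx 1 : 'rV_1) 0 0.
  rewrite /ext (exchange_big_dep xpredT)//= mxE; apply: eq_bigr => m _.
  by rewrite (big_pred1 (enum_val m)) ?mxE ?mulr1// => k; rewrite eq_sym.
have ext_comb v : \sum_k ext v k *: P k =
    v *m \matrix_(m < #|S|) P (enum_val m).
  under eq_bigr do rewrite /ext scaler_suml.
  rewrite (exchange_big_dep xpredT)//=; apply/rowP => q.
  rewrite summxE mxE; apply: eq_bigr => m _.
  by rewrite (big_pred1 (enum_val m)) ?mxE// => k; rewrite eq_sym.
have Mfree : row_free M.
  apply: inj_row_free => v; rewrite mul_mx_row => vM.
  have [v1 v2] : v *m \matrix_(m < #|S|) P (enum_val m) = 0 /\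
      v *m const_mx 1 = 0 :> 'rV_1.
    by apply: eq_row_mx; rewrite vM row_mx0.
  apply/rowP => m; rewrite mxE -ext_in; apply: indep; first exact: ext_out.
    by rewrite ext_sum v2 mxE.
  by rewrite ext_comb v1.
have Mfull : row_full M by rewrite /row_full (eqP Mfree) addn1 cardS.
have /submxP[v vE] : (row_mx x (const_mx 1 : 'rV_1) <= M)%MS by exact: submx_full.
move: vE; rewrite mul_mx_row => /eq_row_mx[xv onev].
exists (ext v); split; first exact: ext_out.
  by rewrite ext_sum -onev mxE.
by rewrite ext_comb.
Qed.

(* [G k] and [B k] are the gradient and the constant term of the k-th
   barycentric coordinate of the simplex with vertices [P m], [m \in S]. *)
Definition barycentric P S G B : Prop :=
  forall k m, m \in S -> dot (G k) (P m) + B k = (m == k)%:R.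

Section coordinates.
Variables (P : I -> 'rV[R]_d) (S : {set I}) (G : I -> 'rV[R]_d) (B : I -> R).
Hypotheses (cardS : #|S| = d.+1) (indep : affinely_independent P S)
  (bary : barycentric P S G B).
Local Notation L k x := (dot (G k) x + B k).

Lemma barycentric_comb (w : I -> R) k :
  (forall m, m \notin S -> w m = 0) -> \sum_m w m = 1 ->
  L k (\sum_m w m *: P m) = w k.
Proof.
(* The constant term is spread over the weights, which sum to 1; each summand is then [w m] times
   the value at the vertex [P m]. *)
move=> wS w1; rewrite dot_sumr -[B k]mul1r -w1 mulr_suml -big_split /=.
rewrite (bigD1 k)//= big1 ?addr0 => [|m mk].
  rewrite dotZr -mulrDr; have [kS|/wS ->] := boolP (k \in S); last by rewrite mul0r.
  by rewrite bary// eqxx mulr1.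
rewrite dotZr -mulrDr; have [mS|/wS ->] := boolP (m \in S); last by rewrite mul0r.
by rewrite bary// (negbTE mk) mulr0.
Qed.

Lemma barycentric_sum x : \sum_k L k x = 1.
Proof.
have [w [wS w1 ->]] := simplex_span x cardS indep.
by rewrite -[RHS]w1; apply: eq_bigr => k _; rewrite barycentric_comb.
Qed.

Lemma barycentric_decomp x : x = \sum_k L k x *: P k.
Proof.
have [w [wS w1 xE]] := simplex_span x cardS indep.
by rewrite {1}xE; apply: eq_bigr => k _; rewrite xE barycentric_comb.
Qed.

Lemma barycentric_out k x : k \notin S -> L k x = 0.
Proof.
have [w [wS w1 ->]] := simplex_span x cardS indep.
by rewrite barycentric_comb//; apply: wS.
Qed.

(** The coordinate vanishes identically: its value at 0 kills the constant term, and its value at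
    [G k] is then |G k|^2. *)
Lemma barycentric_grad_out k : k \notin S -> G k = 0.
Proof.
move=> kS; have := barycentric_out 0 kS; rewrite dot0r add0r => B0.
by apply/eqP; rewrite -dot_eq0; have := barycentric_out (G k) kS; rewrite B0 addr0 => ->.
Qed.

Lemma hull_barycentric x : hull P S x <-> forall k, 0 <= L k x.
Proof.
split=> [[w [w0 wS w1 ->]] k|Lx]; first by rewrite barycentric_comb.
exists (fun k => L k x); split=> //; first by move=> k; exact: barycentric_out.
  exact: barycentric_sum.
exact: barycentric_decomp.
Qed.

Lemma grad_decomp w : w = \sum_k dot (G k) w *: P k.
Proof.
transitivity (\sum_k L k w *: P k - \sum_k L k 0 *: P k).
  by rewrite -!barycentric_decomp subr0.
by rewrite -sumrB; apply: eq_bigr => k _; rewrite -scalerBl dot0r add0r addrK.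
Qed.

Lemma grad_sum w : \sum_k dot (G k) w = 0.
Proof.
transitivity (\sum_k L k w - \sum_k L k 0).
  by rewrite -sumrB; apply: eq_bigr => k _; rewrite dot0r add0r addrK.
by rewrite !barycentric_sum subrr.
Qed.

Lemma grad_edge k m l : m \in S -> l \in S ->
  dot (G k) (P m - P l) = (m == k)%:R - (l == k)%:R.
Proof. by move=> mS lS; rewrite dotBr -!bary// opprD addrACA subrr addr0. Qed.

Lemma grad_neq0 k m : k \in S -> m \in S -> m != k -> G k != 0.
Proof.
move=> kS mS mk; apply/eqP => Gk0; have := grad_edge k kS mS.
by rewrite Gk0 dot0l eqxx (negbTE mk) subr0 => /eqP; rewrite eq_sym oner_eq0.
Qed.

(** A third vertex makes the two gradients independent: [w] pairs with the edge [P j - P m] to |G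
    i|^2, so it is nonzero, and |w|^2 is |G i|^2 times the Gram determinant. *)
Lemma grad_gram_gt0 i j m : i \in S -> j \in S -> m \in S ->
  i != j -> m != i -> m != j ->
  0 < dot (G i) (G i) * dot (G j) (G j) - dot (G i) (G j) ^+ 2.
Proof.
move=> iS jS mS ij mi mj; have Gi0 := grad_neq0 iS mS mi.
pose w := dot (G i) (G i) *: G j - dot (G i) (G j) *: G i.
have w0 : w != 0.
  apply/eqP => w0; have : dot w (P j - P m) = 0 by rewrite w0 dot0l.
  rewrite dotBl !dotZl !grad_edge// eqxx (negbTE mj) (negbTE mi).
  rewrite eq_sym (negbTE ij) !subr0 mulr0 subr0 mulr1 => /eqP.
  by rewrite dot_eq0 (negbTE Gi0).
rewrite -(pmulr_rgt0 _ (dot_gt0 Gi0)); have := dot_gt0 w0.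
by rewrite /w !dotE [dot (G j) (G i)]dotC; lra.
Qed.

(** The inclusions say on which side of each face [u] and [v] point. The common vertices span all
    directions orthogonal to both gradients, so [u] and [v] lie in the plane of the gradients and
    [cos_vangle_normals] applies. *)
Lemma interior_angle_grad i j (A A' : set 'rV[R]_d) theta :
  (1 < d)%N -> i \in S -> j \in S -> i != j ->
  A `<=` [set x | L i x = 0 /\ 0 <= L j x] ->
  A' `<=` [set x | L j x = 0 /\ 0 <= L i x] ->
  (forall m, m \in S -> m != i -> m != j -> (A `&` A') (P m)) ->
  interior_angle A A' theta ->
  dot (G i) (G j) = - (enorm (G i) * enorm (G j) * cos theta).
Proof.
move=> d1 iS jS ij AL A'L vert [y [u [v [[Ay A'y] [u0 v0] [Ayu A'yv] perp ->]]]].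
have [m [mS mi mj]] : exists m, [/\ m \in S, m != i & m != j].
  have : (0 < #|S :\ i :\ j|)%N.
    have := cardsD1 i S; have := cardsD1 j (S :\ i).
    by rewrite cardS iS !inE jS eq_sym ij /=; lia.
  by case/card_gt0P => m; rewrite !inE => /and3P[mj mi mS]; exists m.
have [Liy _] := AL _ Ay; have [Ljy _] := A'L _ A'y.
have [Liu Lju] := AL _ Ayu; have [Ljv Liv] := A'L _ A'yv.
apply: cos_vangle_normals => //.
- exact: (@grad_gram_gt0 i j m).
- by move: Liu; rewrite dotDr addrAC Liy add0r.
- by move: Lju; rewrite dotDr addrAC Ljy add0r.
- by move: Ljv; rewrite dotDr addrAC Ljy add0r.
- by move: Liv; rewrite dotDr addrAC Liy add0r.
- move=> w iw jw.
  (* As the gradients sum to 0, [w] decomposes along the edges from [P m]; its components along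
     [P i - P m] and [P j - P m] vanish. *)
  have wE : w = \sum_k dot (G k) w *: (P k - P m).
    under eq_bigr do rewrite scalerBr.
    by rewrite sumrB -scaler_suml grad_sum scale0r subr0 -grad_decomp.
  suff H x : (forall k, k \in S -> k != i -> k != j -> dot (P k - P m) x = 0) ->
      dot w x = 0.
    split; apply: H => k kS ki kj;
      by have [] := perp _ _ (vert k kS ki kj) (vert m mS mi mj).
  move=> Hx; rewrite wE dotC dot_sumr big1// => k _; rewrite dotZr [dot x _]dotC.
  have [->|ki] := eqVneq k i; first by rewrite iw mul0r.
  have [->|kj] := eqVneq k j; first by rewrite jw mul0r.
  have [kS|kS] := boolP (k \in S); last by rewrite barycentric_grad_out// dot0l mul0r.
  by rewrite Hx// mulr0.
Qed.

End coordinates.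
End simplex.

(** * Faces of elements *)

Section topology.
Context {R : realType} {d : nat}.
Implicit Types (x v g : 'rV[R]_d) (b : R) (A : set 'rV[R]_d).

Lemma continuous_affine g b : continuous (fun x => dot g x + b).
Proof.
have cd : continuous (fun x : 'rV[R]_d => dot g x).
  apply: (continuous_big add_continuous) => k _ x.
  by apply: continuousM; [exact: cst_continuous|exact: coord_continuous].
by move=> x; apply: continuousD; [exact: cd|exact: cst_continuous].
Qed.

Lemma continuous_line x v : continuous (fun t : R => x + t *: v).
Proof.
by move=> t; apply: cvgD; [exact: cvg_cst|apply: cvgZr_tmp; exact: cvg_id].
Qed.

Lemma nbhs_line x v A : nbhs x A -> \forall t \near (0 : R)^'+, A (x + t *: v).
Proof.
move=> xA; have : x + t *: v @[t --> (0 : R)^'+] --> x; last exact.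
apply: cvg_at_right_filter; have := @continuous_line x v (0 : R).
by rewrite /continuous_at scale0r addr0.
Qed.

Lemma closure_line x v A :
  (forall t, 0 < t < 1 -> A (x + t *: v)) -> closure A x.
Proof.
move=> Av U /(nbhs_line v) xU.
have [t [[Ut t0] t1]] : exists t : R, (U (x + t *: v) /\ 0 < t) /\ t < 1.
  apply: (@filter_ex _ (0 : R)^'+); near=> t; split; first split.
  - by near: t.
  - by near: t; exact: nbhs_right_gt.
  - by near: t; exact: nbhs_right_lt.
by exists (x + t *: v); split=> //; apply: Av; rewrite t0.
Unshelve. all: by end_near. Qed.

End topology.

Lemma hull_vertex {R : realType} {d : nat} {I : finType} (P : I -> 'rV[R]_d)
  (S : {set I}) m : m \in S -> hull P S (P m).
Proof.
move=> mS; exists (fun k => (k == m)%:R); split.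
- by move=> k; rewrite ler0n.
- by move=> k kS; case: eqP => // km; move: kS; rewrite km mS.
- by rewrite (bigD1 m)//= eqxx big1 ?addr0// => k /negbTE ->.
- rewrite (bigD1 m)//= eqxx scale1r big1 ?addr0// => k /negbTE ->.
  by rewrite scale0r.
Qed.

Section mesh.
Context {R : realType} {d Np Ne : nat}.
Variables (Omega : set 'rV[R]_d) (P : 'I_Np -> 'rV[R]_d).
Variables (T : 'I_Ne -> {set 'I_Np}) (phi : 'I_Np -> 'rV[R]_d -> R).
Hypotheses (hT : triangulation Omega P T) (hphi : nodal_basis Omega P T phi).
Local Notation elt := (element P T).

Lemma element_closure alpha x : elt alpha x -> closure Omega x.
Proof. by move=> ax; rewrite (mesh_cover hT); exists alpha. Qed.

Lemma nodal_affine : exists (G : 'I_Ne -> 'I_Np -> 'rV[R]_d) (B : 'I_Ne -> 'I_Np -> R),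
  forall alpha k x, elt alpha x -> phi k x = dot (G alpha k) x + B alpha k.
Proof.
have H (ak : 'I_Ne * 'I_Np) : exists gb : 'rV[R]_d * R,
    forall x, elt ak.1 x -> phi ak.2 x = dot gb.1 x + gb.2.
  have [[_ aff] _] := hphi ak.2; have [g [b gb]] := aff ak.1.
  by exists (g, b).
have [F HF] := choice H.
exists (fun alpha k => (F (alpha, k)).1), (fun alpha k => (F (alpha, k)).2).
by move=> alpha k; exact: HF (alpha, k).
Qed.

Variables (G : 'I_Ne -> 'I_Np -> 'rV[R]_d) (B : 'I_Ne -> 'I_Np -> R).
Hypothesis phiE :
  forall alpha k x, elt alpha x -> phi k x = dot (G alpha k) x + B alpha k.
Local Notation L alpha k x := (dot (G alpha k) x + B alpha k).

Lemma element_barycentric alpha : barycentric P (T alpha) (G alpha) (B alpha).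
Proof.
move=> k m ma; rewrite -phiE; last exact: hull_vertex.
by have [_ ->] := hphi k.
Qed.

Let cardT := mesh_simplex hT.
Let indepT := mesh_nondegenerate hT.
Let baryT := element_barycentric.

Lemma elementP alpha x : elt alpha x <-> forall k, 0 <= L alpha k x.
Proof. exact: (hull_barycentric (cardT alpha) (@indepT alpha) (@baryT alpha)). Qed.

Lemma element_coord_out alpha k x : k \notin T alpha -> L alpha k x = 0.
Proof. exact: (barycentric_out (cardT alpha) (@indepT alpha) (@baryT alpha)). Qed.

Lemma phi_ge0 alpha k x : elt alpha x -> 0 <= phi k x.
Proof. by move=> ax; rewrite (phiE _ ax); exact: (elementP alpha x).1. Qed.

Lemma closed_element alpha : closed (elt alpha).
Proof.
have -> : elt alpha = \bigcap_(k in [set: 'I_Np])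
    ((fun x => L alpha k x) @^-1` [set r | 0 <= r]).
  apply/seteqP; split => x; first by move=> /elementP ax k _; exact: ax.
  by move=> ax; apply/elementP => k; exact: ax.
apply: closed_bigI => k _; apply: closed_comp; last exact: closed_ge.
by move=> x _; exact: continuous_affine.
Qed.

Lemma coord_line alpha k m x t : m \in T alpha ->
  L alpha k (P m + t *: (x - P m)) = (1 - t) * (m == k)%:R + t * L alpha k x.
Proof. by move=> ma; rewrite -(baryT k ma) !dotE; ring. Qed.

(* The homothety of small ratio t centred at P i maps a neighbourhood of x into
   a neighbourhood of P i, hence into the mesh; it only rescales the barycentric
   coordinates other than the i-th, so the mesh covers a neighbourhood of x. *)
Lemma star_interior alpha i x : interior (closure Omega) (P i) ->
  elt alpha x -> 0 < phi i x -> interior (closure Omega) x.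
Proof.
move=> Pi ax phix.
have Lix : 0 < L alpha i x by rewrite -phiE.
have ia : i \in T alpha.
  by apply: contraTT Lix => /(element_coord_out x) ->; rewrite ltxx.
pose h t z : 'rV[R]_d := P i + t *: (z - P i).
have [t [[Ct t0] t1]] :
    exists t, (interior (closure Omega) (h t x) /\ 0 < t) /\ t < 1.
  apply: (@filter_ex _ (0 : R)^'+); near=> t; split; first split.
  - near: t; apply: nbhs_line; exact: nbhs_interior.
  - by near: t; exact: nbhs_right_gt.
  - by near: t; exact: nbhs_right_lt.
have ch : continuous (h t).
  by move=> z; apply: (@continuousD _ _ _ (cst (P i)) (t \*: (id - cst (P i))));
    [exact: cst_continuous|apply: continuousZl_tmp; apply: continuousB;
      [exact: cvg_id|exact: cst_continuous]].
have ay : elt alpha (h t x).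
  apply/elementP => k; rewrite coord_line//.
  apply: addr_ge0; apply: mulr_ge0; rewrite ?subr_ge0 ?ler0n ?(ltW t0) ?(ltW t1)//.
  exact: (elementP alpha x).1.
(* [phi i] takes one value at [h t x], so the [i]-th coordinates of [alpha] and [beta] agree there.
   This value is positive, which makes [P i] a vertex of [beta]. *)
have phiy beta : elt beta (h t x) ->
    L beta i (h t x) = (1 - t) + t * L alpha i x.
  by move=> bY; rewrite -phiE// (phiE i ay) coord_line// eqxx mulr1.
have ib beta : elt beta (h t x) -> i \in T beta.
  move=> bY; apply/negP => /negP /(element_coord_out (h t x)).
  rewrite phiy// => /eqP; rewrite gt_eqF// addr_gt0 ?subr_gt0// mulr_gt0//.
(* If [beta] contains [h t x], its [i]-th coordinate is positive at [x] and stays so nearby. If not,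
   [beta] is closed and also misses [h t z] for [z] near [x]. *)
have near_beta beta : \forall z \near x,
    elt beta (h t z) -> 0 < L beta i z /\ i \in T beta.
  have [bY|bY] := pselect (elt beta (h t x)).
    have Lbx : 0 < L beta i x.
      have := phiy _ bY; rewrite coord_line ?ib// eqxx mulr1.
      by move/addrI/(mulfI (negbT (gt_eqF t0))) ->.
    near=> z => _; split; last exact: ib.
    by near: z; apply: cvgr_gt Lbx; exact: continuous_affine.
  have oC : open (~` elt beta) by apply: closed_openC; exact: closed_element.
  have nb : \forall z \near x, ~ elt beta (h t z).
    exact: (ch x _ (open_nbhs_nbhs (conj oC bY))).
  by apply: filterS nb => z nbz /nbz.
have all_beta : \forall z \near x, forall beta,
    elt beta (h t z) -> 0 < L beta i z /\ i \in T beta.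
  exact: filter_forall near_beta.
have Cz : \forall z \near x, closure Omega (h t z) by exact: (ch x _ Ct).
near=> z.
have Lpos : forall beta, elt beta (h t z) -> 0 < L beta i z /\ i \in T beta.
  by near: z.
have : closure Omega (h t z) by near: z.
rewrite (mesh_cover hT) => -[beta _ bz].
have [Lz ibeta] := Lpos _ bz.
(* For k distinct from [i] the homothety multiplies the [k]-th coordinate by t > 0, so its sign
   carries over from [h t z] to [z]. *)
exists beta => //; apply/elementP => k.
have := (elementP beta (h t z)).1 bz k; rewrite coord_line//.
have [<- _|ik] := eqVneq i k; first exact: ltW.
by rewrite mulr0 add0r pmulr_rge0.
Unshelve. all: by end_near. Qed.

Lemma overlapC i j : overlap Omega phi i j = overlap Omega phi j i.
Proof. by apply/seteqP; split => x []; split. Qed.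

Lemma element_faceC i j l alpha :
  element_face Omega P T phi i j l alpha = element_face Omega P T phi j i l alpha.
Proof. by rewrite /element_face /overlap_boundary overlapC. Qed.

(** By [star_interior] the mesh covers a neighbourhood of [x]. Continuity within the closure of
    [Omega] is therefore plain continuity at [x], and both nodal functions stay positive nearby. *)
Lemma overlap_interior alpha i j x :
  interior (closure Omega) (P i) \/ interior (closure Omega) (P j) ->
  elt alpha x -> 0 < phi i x -> 0 < phi j x ->
  interior (overlap Omega phi i j) x.
Proof.
move=> ij ax phix phjx.
have Cx : interior (closure Omega) x.
  by case: ij => ?; [apply: (@star_interior alpha i)|apply: (@star_interior alpha j)].
have near_phi k : 0 < phi k x -> \forall z \near x, phi k z != 0.
  move=> kx; have [[phic _] _] := hphi k.
  have phicx : phi k z @[z --> x] --> phi k x.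
    by have := phic x; rewrite /continuous_at -(nbhs_subspace_interior Cx).
  by apply: filterS (cvgr_gt _ phicx _ kx) => z; exact: lt0r_neq0.
by near=> z; split; near: z; [exact: Cx|exact: near_phi|exact: near_phi].
Unshelve. all: by end_near. Qed.

(** At a point of the face [phi j] is nonzero, so [phi i] must vanish: otherwise [overlap_interior]
    would place the point in the interior of the overlap. The target set is closed, so the closure
    follows. *)
Lemma closure_face_sub alpha i j :
  interior (closure Omega) (P i) \/ interior (closure Omega) (P j) ->
  closure (element_face Omega P T phi i j j alpha) `<=`
  [set x | L alpha i x = 0 /\ 0 <= L alpha j x].
Proof.
move=> ij; set F := [set x | _].
have cF : closed F.
  have -> : F = (fun x => L alpha i x) @^-1` [set 0] `&`
                (fun x => L alpha j x) @^-1` [set r | 0 <= r] by [].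
  apply: closedI; apply: closed_comp.
  - by move=> x _; exact: continuous_affine.
  - exact: closed_eq.
  - by move=> x _; exact: continuous_affine.
  - exact: closed_ge.
apply: (subset_trans _ cF); apply: closure_subset => x [[[_ nint] phjx] [cx _]].
have ax : elt alpha x by exact: closed_element cx.
rewrite /F /= -!phiE//; split; last exact: phi_ge0 ax.
apply/eqP; rewrite eq_le (phi_ge0 i ax) andbT leNgt; apply/negP => phix.
apply: nint; apply: (@overlap_interior alpha) => //.
by rewrite lt_def phjx (phi_ge0 _ ax).
Qed.

(** The points of the segment from [x] towards [P i] lie in the overlap, whereas [x] does not since
    [phi i x = 0]. Moving from [x] against [G alpha i] makes the [i]-th coordinate negative, so [x]
    is also on the boundary of the element. *)
Lemma element_face_mem alpha i j x : i \in T alpha -> j \in T alpha -> i != j ->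
  elt alpha x -> phi i x = 0 -> 0 < phi j x ->
  element_face Omega P T phi i j j alpha x.
Proof.
move=> ia ja ij ax phix phjx; split; split.
- split.
    apply: (@closure_line _ _ _ (P i - x)) => t /andP[t0 t1].
    have -> : x + t *: (P i - x) = P i + (1 - t) *: (x - P i).
      by apply/rowP => q; rewrite !mxE; ring.
    have ay : elt alpha (P i + (1 - t) *: (x - P i)).
      apply/elementP => k; rewrite coord_line// subKr.
      apply: addr_ge0; apply: mulr_ge0;
        rewrite ?subr_ge0 ?ler0n ?(ltW t0) ?(ltW t1)//.
      exact: (elementP alpha x).1.
    split; first exact: element_closure ay.
      rewrite (phiE _ ay) coord_line// -phiE// phix eqxx mulr0 addr0 mulr1.
      by rewrite subKr gt_eqF.
    rewrite (phiE _ ay) coord_line// -phiE// (negbTE ij) mulr0 add0r.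
    by rewrite gt_eqF// mulr_gt0//; lra.
  by move=> /interior_subset[_ /negP]; rewrite phix.
- by rewrite gt_eqF.
- exact: subset_closure.
- move=> /(@nbhs_line _ _ x (- G alpha i)) H.
  have [t [axt t0]] : exists t : R, elt alpha (x + t *: - G alpha i) /\ 0 < t.
    apply: (@filter_ex _ (0 : R)^'+); near=> t; split; first by near: t.
    by near: t; exact: nbhs_right_gt.
  have := (elementP alpha _).1 axt i; move: phix; rewrite (phiE _ ax) => Lx.
  rewrite dotDr addrAC Lx add0r dotZr dotNr leNgt => /negP; apply.
  rewrite mulrN oppr_lt0 mulr_gt0// dot_gt0//.
  by apply: (grad_neq0 (@baryT alpha) ia ja); rewrite eq_sym.
Unshelve. all: by end_near. Qed.

(** [phi j] vanishes at [P m], so this vertex is only a limit of points of the face, taken along the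
    edge towards [P j]. *)
Lemma closure_face_vertex alpha i j m : i \in T alpha -> j \in T alpha ->
  i != j -> m \in T alpha -> m != i -> m != j ->
  closure (element_face Omega P T phi i j j alpha) (P m).
Proof.
move=> ia ja ij ma mi mj.
apply: (@closure_line _ _ _ (P j - P m)) => t /andP[t0 t1].
have ay : elt alpha (P m + t *: (P j - P m)).
  apply/elementP => k; rewrite coord_line// baryT//.
  by apply: addr_ge0; apply: mulr_ge0;
    rewrite ?subr_ge0 ?ler0n ?(ltW t0) ?(ltW t1).
apply: element_face_mem => //; rewrite (phiE _ ay) coord_line// baryT//.
  by rewrite (negbTE mi) eq_sym (negbTE ij) !mulr0 addr0.
by rewrite (negbTE mj) eqxx mulr0 add0r mulr1.
Qed.

Lemma element_angle_grad alpha i j theta : (1 < d)%N ->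
  i \in T alpha -> j \in T alpha -> i != j ->
  interior (closure Omega) (P i) \/ interior (closure Omega) (P j) ->
  interior_angle (closure (element_face Omega P T phi i j j alpha))
                 (closure (element_face Omega P T phi i j i alpha)) theta ->
  dot (G alpha i) (G alpha j) =
  - (enorm (G alpha i) * enorm (G alpha j) * cos theta).
Proof.
move=> d1 ia ja ij int.
have ji : j != i by rewrite eq_sym.
have tni : interior (closure Omega) (P j) \/ interior (closure Omega) (P i).
  by case: int; [right|left].
rewrite [in X in interior_angle _ X]element_faceC.
apply: (interior_angle_grad (cardT alpha) (indepT (alpha := alpha)) (@baryT alpha)) => //.
- exact: closure_face_sub.
- exact: closure_face_sub.
- by move=> m ma mi mj; split; apply: closure_face_vertex.
Qed.

End mesh.

(** * The spring constant as a sum over elements *)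

Lemma hyperplanes_null {R : realType} {d : nat} (I : finType) (Q : pred I)
    (g : I -> 'rV[R]_d) (b : I -> R) : (forall i, Q i -> g i != 0) ->
  exists N, [/\ measurable N, lebesgue_tuple R d N = 0%E &
    forall i t, Q i -> hyperplane (g i) (b i) (row_of t) -> N t].
Proof.
move=> g0.
suff [N [mN N0 HN]] : exists N, [/\ measurable N, lebesgue_tuple R d N = 0%E &
    forall i t, i \in enum I -> Q i -> hyperplane (g i) (b i) (row_of t) -> N t].
  by exists N; split=> // i t; apply: HN; rewrite mem_enum.
elim: (enum I) => [|i s [N [mN N0 HN]]]; first by exists set0; rewrite measure0; split.
have [Qi|nQi] := boolP (Q i); last first.
  exists N; split=> // k t; rewrite inE => /predU1P[->|]; last exact: HN.
  by rewrite (negbTE nQi).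
pose H := @row_of R d @^-1` hyperplane (g i) (b i).
have mH : measurable H by exact: measurable_hyperplane.
exists (H `|` N); split.
- exact: measurableU.
- by rewrite measureU0//; apply: hyperplane_null; exact: g0.
- by move=> k t; rewrite inE => /predU1P[-> _ Ht|ks Qk Ht]; [left|right; exact: HN Ht].
Qed.

(** The [d] rows (Q k, 1) have [d + 1] columns, so some nonzero (g, c) annihilates them all; g = 0
    would force c = 0, as there is at least one point. *)
Lemma hyperplane_through {R : realType} {d : nat} (Q : 'I_d -> 'rV[R]_d) :
  (0 < d)%N -> exists g b, g != 0 /\ forall k, hyperplane g b (Q k).
Proof.
move=> d0; pose A : 'M[R]_(d, d + 1) := row_mx (\matrix_k Q k) (const_mx 1).
have : kermx A^T != 0.
  rewrite kermx_eq0 /row_free; apply/eqP => rA.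
  by have := rank_leq_col A^T; rewrite rA addn1 ltnn.
case/rowV0Pn => v /sub_kermxP vA v0.
have vE := hsubmxK v; set g := lsubmx v in vE; set c := rsubmx v in vE.
have HQ k : hyperplane g (c 0 0) (Q k).
  have : (v *m A^T) 0 k = 0 by rewrite vA mxE.
  rewrite /hyperplane /= -vE tr_row_mx mul_row_col => <-; rewrite [RHS]mxE.
  rewrite [X in _ = _ + X]mxE big_ord1 !mxE mulr1; congr (_ + _).
  by apply: eq_bigr => q _; rewrite !mxE.
exists g, (c 0 0); split=> //; apply: contra v0 => /eqP g0.
have := HQ (Ordinal d0); rewrite /hyperplane /= g0 dot0l add0r => c0.
rewrite -vE g0 (_ : c = 0) ?row_mx0//.
by apply/rowP => q; rewrite ord1 c0 [RHS]mxE.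
Qed.

Lemma hull_hyperplane {R : realType} {d : nat} {I : finType}
    (P : I -> 'rV[R]_d) (S : {set I}) (g : 'rV[R]_d) (b : R) :
  (forall k, k \in S -> hyperplane g b (P k)) -> hull P S `<=` hyperplane g b.
Proof.
move=> HP _ [w [_ wS w1 ->]]; rewrite /hyperplane /=.
rewrite dot_sumr -[b]mul1r -w1 mulr_suml -big_split big1//= => k _.
rewrite dotZr -mulrDr; have [kS|/wS ->] := boolP (k \in S); last by rewrite mul0r.
by rewrite HP// mulr0.
Qed.

(** * Derivatives of affine functions and the isotropic energy density *)

Section derivatives.
Context {R : realType} {d : nat}.
Implicit Types (f : 'rV[R]_d -> R) (g x v : 'rV[R]_d) (b : R).

Lemma partial_affine f g b x q :
  (\forall y \near x, f y = dot g y + b) -> partial q f x = g 0 q.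
Proof.
move=> fE; rewrite /partial -dot_delta; set v := delta_mx 0 q.
apply: cvg_lim => //; apply: cvg_near_cst.
have xv : h *: v + x @[h --> (0 : R)^'] --> x.
  apply: cvg_within_filter; have := @continuous_line R d x v 0.
  rewrite /continuous_at scale0r addr0; under eq_fun do rewrite addrC.
  exact.
near=> h.
have h0 : h != 0 by near: h; exact: nbhs_dnbhs_neq.
have fh : f (h *: v + x) = dot g (h *: v + x) + b.
  by near: h; exact: (xv _ fE).
rewrite /= fh (nbhs_singleton fE) (_ : _ - _ = h * dot g v) ?[_ *: _]mulKf//.
by rewrite !dotE; ring.
Unshelve. all: by end_near. Qed.

Lemma sum_delta (l : 'I_d) (F : 'I_d -> R) : \sum_p (p == l)%:R * F p = F l.
Proof.
rewrite (bigD1 l)//= eqxx mul1r big1 ?addr0// => p /negbTE ->.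
by rewrite mul0r.
Qed.

Lemma isotropic_stress (lambda mu : R) (E : 'I_d -> 'I_d -> R) p q :
  \sum_r \sum_s isotropic lambda mu p q r s * E r s =
  lambda * ((p == q)%:R * \sum_r E r r) + mu * (E p q + E q p).
Proof.
transitivity (lambda * ((p == q)%:R * \sum_r \sum_s (s == r)%:R * E r s) +
  mu * (\sum_r (r == p)%:R * \sum_s (s == q)%:R * E r s +
        \sum_r (r == q)%:R * \sum_s (s == p)%:R * E r s)).
  rewrite -big_split !mulr_sumr -big_split /=; apply: eq_bigr => r _.
  rewrite !mulr_sumr -big_split !mulr_sumr -big_split /=; apply: eq_bigr => s _.
  rewrite /isotropic [r == p]eq_sym [s == q]eq_sym [s == p]eq_sym [s == r]eq_sym.
  by rewrite [r == q]eq_sym; ring.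
by rewrite !sum_delta; congr (_ * (_ * _) + _); apply: eq_bigr => r _; rewrite sum_delta.
Qed.

Lemma isotropic_energy (lambda mu : R) (a b : 'rV[R]_d) (k l : 'I_d) :
  let E p q := 2^-1 * ((p == l)%:R * a 0 q + (q == l)%:R * a 0 p) in
  let F p q := 2^-1 * ((p == k)%:R * b 0 q + (q == k)%:R * b 0 p) in
  \sum_p \sum_q (\sum_r \sum_s isotropic lambda mu p q r s * E r s) * F p q =
  lambda * (a 0 l * b 0 k) +
  mu * ((l == k)%:R * dot a b + a 0 k * b 0 l).
Proof.
move=> E F; have EC p q : E p q = E q p by rewrite /E addrC.
have trE : \sum_r E r r = a 0 l.
  rewrite -(sum_delta l (a 0)); apply: eq_bigr => r _.
  by rewrite /E; field.
have trF : \sum_r F r r = b 0 k.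
  rewrite -(sum_delta k (b 0)); apply: eq_bigr => r _.
  by rewrite /F; field.
(* The energy is lambda tr E tr F + 2 mu E:F, where E:F is expanded into its four products of
   Kronecker deltas. *)
transitivity (lambda * (a 0 l * \sum_p \sum_q (q == p)%:R * F p q) +
    mu * 2^-1 *
    (\sum_p (p == l)%:R * (\sum_q (p == k)%:R * (a 0 q * b 0 q)) +
     \sum_p (p == l)%:R * (\sum_q (q == k)%:R * (a 0 q * b 0 p)) +
     \sum_p (p == k)%:R * (\sum_q (q == l)%:R * (a 0 p * b 0 q)) +
     \sum_p a 0 p * b 0 p * (\sum_q (q == l)%:R * (q == k)%:R))).
  rewrite -!big_split !mulr_sumr -big_split /=; apply: eq_bigr => p _.
  rewrite !mulr_sumr -!big_split /= !mulr_sumr -big_split /=; apply: eq_bigr => q _.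
  by rewrite isotropic_stress trE [E q p]EC [q == p]eq_sym /E /F; field.
rewrite !sum_delta.
have -> : \sum_p \sum_q (q == p)%:R * F p q = b 0 k.
  by rewrite -trF; apply: eq_bigr => p _; rewrite sum_delta.
by rewrite -mulr_suml -/(dot a b) -mulr_sumr -/(dot a b); field.
Qed.

Lemma isotropic_quadratic (lambda mu : R) (a b x : 'rV[R]_d) :
  \sum_k \sum_l (lambda * (a 0 l * b 0 k) +
    mu * ((l == k)%:R * dot a b + a 0 k * b 0 l)) * x 0 l * x 0 k =
  (lambda + mu) * (dot a x * dot b x) + mu * dot a b * dot x x.
Proof.
transitivity (lambda * \sum_k b 0 k * x 0 k * (\sum_l a 0 l * x 0 l) +
   mu * (dot a b * \sum_k x 0 k * (\sum_l (l == k)%:R * x 0 l) +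
         \sum_k a 0 k * x 0 k * (\sum_l b 0 l * x 0 l))).
  rewrite !mulr_sumr -big_split !mulr_sumr -big_split /=; apply: eq_bigr => k _.
  rewrite !mulr_sumr -big_split !mulr_sumr -big_split /=; apply: eq_bigr => l _.
  by ring.
under [\sum_k x 0 k * _]eq_bigr do rewrite sum_delta.
by rewrite -!mulr_suml /dot; ring.
Qed.

End derivatives.

Section mesh_spring.
Context {R : realType} {d Np Ne : nat}.
Variables (Omega : set 'rV[R]_d) (P : 'I_Np -> 'rV[R]_d).
Variables (T : 'I_Ne -> {set 'I_Np}) (phi : 'I_Np -> 'rV[R]_d -> R).
Hypotheses (hT : triangulation Omega P T) (hphi : nodal_basis Omega P T phi).
Variables (G : 'I_Ne -> 'I_Np -> 'rV[R]_d) (B : 'I_Ne -> 'I_Np -> R).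
Hypothesis phiE : forall alpha k x,
  element P T alpha x -> phi k x = dot (G alpha k) x + B alpha k.
Local Notation elt := (element P T).
Local Notation L alpha k x := (dot (G alpha k) x + B alpha k).

Let elementP := elementP hT hphi phiE.

Lemma nbhs_element alpha x :
  (forall k, k \in T alpha -> 0 < L alpha k x) -> \forall y \near x, elt alpha y.
Proof.
move=> Lx.
have near_pos k : \forall y \near x, 0 <= L alpha k y.
  have [ka|ka] := boolP (k \in T alpha); last first.
    by near=> y; rewrite (element_coord_out hT hphi phiE).
  have cL := @continuous_affine _ _ (G alpha k) (B alpha k) x.
  apply: filterS (cvgr_gt _ cL _ (Lx k ka)).
  by move=> y; exact: ltW.
by apply: filterS (filter_forall _ near_pos) => y; rewrite elementP.
Unshelve. all: by end_near. Qed.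

(** By conformity [x] is a convex combination of the common vertices. Its coordinates in [alpha] are
    all positive, so every vertex of [alpha] is common, and the cardinalities agree. *)
Lemma element_interior_inj alpha beta x :
  (forall k, k \in T alpha -> 0 < L alpha k x) -> elt beta x -> alpha = beta.
Proof.
move=> Lx bx; have ax : elt alpha x by exact: nbhs_singleton (nbhs_element Lx).
have : hull P (T alpha :&: T beta)%SET x.
  by rewrite -(mesh_conforming hT).
move=> [w [_ wS w1 xE]].
have sub : T alpha \subset T beta.
  apply/fintype.subsetP => k ka; apply: contraTT (Lx k ka) => kb.
  have wk m : m \notin T alpha -> w m = 0.
    by move=> ma; apply: wS; rewrite inE negb_and ma.
  rewrite xE (barycentric_comb (element_barycentric hphi phiE (alpha := alpha)) _ wk)//.
  by rewrite wS ?ltxx// inE negb_and kb orbT.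
apply: (mesh_elt_inj hT); apply/eqP.
by rewrite eqEcard sub !(mesh_simplex hT) leqnn.
Qed.

Lemma strain_basis alpha j l p q x :
  (\forall y \near x, elt alpha y) ->
  strain (fun y => phi j y *: delta_mx 0 l) p q x =
  2^-1 * ((p == l)%:R * G alpha j 0 q + (q == l)%:R * G alpha j 0 p).
Proof.
move=> ax.
have part r s : partial s (fun y => (phi j y *: delta_mx 0 l : 'rV[R]_d) 0 r) x =
    (r == l)%:R * G alpha j 0 s.
  rewrite (@partial_affine _ _ _ ((r == l)%:R *: G alpha j) ((r == l)%:R * B alpha j)).
    by rewrite mxE.
  apply: filterS ax => y ay; rewrite !mxE eqxx (phiE _ ay) dotZl.
  by rewrite -mulrDr mulrC.
by rewrite /strain !part.
Qed.

Lemma energy_density lambda mu alpha i j k l x :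
  (\forall y \near x, elt alpha y) ->
  \sum_p \sum_q
    stress (isotropic lambda mu) (fun y => phi j y *: delta_mx 0 l) p q x *
    strain (fun y => phi i y *: delta_mx 0 k) p q x =
  lambda * (G alpha j 0 l * G alpha i 0 k) +
  mu * ((l == k)%:R * dot (G alpha j) (G alpha i) + G alpha j 0 k * G alpha i 0 l).
Proof.
move=> ax; rewrite -isotropic_energy.
apply: eq_bigr => p _; apply: eq_bigr => q _; rewrite (strain_basis i k p q ax).
congr (_ * _); apply: eq_bigr => r _; apply: eq_bigr => s _.
by rewrite (strain_basis j l r s ax).
Qed.

Definition volume alpha : R :=
  fine (lebesgue_tuple R d (@row_of R d @^-1` elt alpha)).

Lemma volume_ge0 alpha : 0 <= volume alpha.
Proof. by rewrite fine_ge0// measure_ge0. Qed.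

Lemma measurable_element alpha : measurable (@row_of R d @^-1` elt alpha).
Proof.
have -> : @row_of R d @^-1` elt alpha = \bigcap_(k in [set: 'I_Np])
    (@row_of R d @^-1` [set x | 0 <= L alpha k x]).
  apply/seteqP; split => t /=; first by move=> /elementP at_ k _; exact: at_.
  by move=> at_; apply/elementP => k; exact: at_.
by apply: fin_bigcap_measurable => // k _; exact: measurable_halfspace.
Qed.

Lemma element_lty alpha : (lebesgue_tuple R d (@row_of R d @^-1` elt alpha) < +oo)%E.
Proof.
(* A convex combination has each coordinate bounded by the sum over the vertices; summing also over
   [q] gives one bound for all coordinates. *)
apply: (@lebesgue_tuple_bounded _ _ _ (\sum_q \sum_k `|P k 0 q|)).
  exact: measurable_element.
move=> x q [w [w0 _ w1 ->]]; rewrite summxE.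
apply: le_trans (ler_norm_sum _ _ _) _.
apply: (@le_trans _ _ (\sum_k `|P k 0 q|)).
  apply: ler_sum => k _; rewrite mxE normrM ger0_norm// ler_piMl//.
  by rewrite -w1 (bigD1 k)//= lerDl sumr_ge0.
rewrite [leRHS](bigD1 q)//= lerDl sumr_ge0// => r _.
by apply: sumr_ge0.
Qed.

(* Off finitely many hyperplanes, a point of the closure of Omega lies in Omega
   and in the interior of exactly one element. *)
Lemma spring_sum (hOmega : polyhedral_lipschitz_domain Omega) (d1 : (1 < d)%N)
    lambda mu i j k l :
  spring Omega phi (isotropic lambda mu) i j k l =
  - \sum_alpha (lambda * (G alpha j 0 l * G alpha i 0 k) +
      mu * ((l == k)%:R * dot (G alpha j) (G alpha i) +
            G alpha j 0 k * G alpha i 0 l)) * volume alpha.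
Proof.
rewrite mxE; congr (- _); rewrite /elastic_form.
(* [N1] contains the hyperplanes that carry the faces of the elements, and [N2] below those that
   carry the simplices of the boundary of [Omega]. *)
have [N1 [mN1 N10 HN1]] : exists N, [/\ measurable N, lebesgue_tuple R d N = 0%E &
    forall (ak : 'I_Ne * 'I_Np) t, ak.2 \in T ak.1 ->
      hyperplane (G ak.1 ak.2) (B ak.1 ak.2) (row_of t) -> N t].
  apply: (hyperplanes_null (Q := fun ak => ak.2 \in T ak.1)
    (g := fun ak => G ak.1 ak.2)) => -[alpha m] /= ma.
  have [m' m'a mm'] : exists2 m', m' \in T alpha & m' != m.
    have : (0 < #|T alpha :\ m|)%N.
      by have := cardsD1 m (T alpha); rewrite (mesh_simplex hT) ma; lia.
    by case/card_gt0P => m'; rewrite !inE => /andP[? ?]; exists m'.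
  exact: (grad_neq0 (element_barycentric hphi phiE (alpha := alpha)) ma m'a).
have [n [Q [_ bdE]]] := dom_polyhedral hOmega.
have Hg (a : 'I_n) : exists gb : 'rV[R]_d * R,
    gb.1 != 0 /\ forall q, hyperplane gb.1 gb.2 (Q a q).
  by have [|g [b gb]] := hyperplane_through (Q a); [exact: ltnW|exists (g, b)].
have [gb Hgb] := choice Hg.
have [N2 [mN2 N20 HN2]] : exists N, [/\ measurable N, lebesgue_tuple R d N = 0%E &
    forall (a : 'I_n) t, true -> hyperplane (gb a).1 (gb a).2 (row_of t) -> N t].
  apply: (hyperplanes_null (Q := xpredT) (g := fun a => (gb a).1)) => a _.
  by have [] := Hgb a.
apply: (Rintegral_piecewise_const (N := N1 `|` N2)
  (A := fun alpha => @row_of R d @^-1` elt alpha)).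
- exact: measurableU.
- exact: etrans (measureU0 _ _ _) _.
- exact: measurable_element.
- exact: element_lty.
move=> t /not_orP[N1t N2t].
have pos alpha : elt alpha (row_of t) ->
    forall m, m \in T alpha -> 0 < L alpha m (row_of t).
  move=> at_ m ma; rewrite lt_def ((elementP _ _).1 at_) andbT.
  by apply/eqP => L0; apply: N1t; exact: (HN1 (alpha, m)).
rewrite patchE; case: ifPn; rewrite ?inE /=.
  move=> Ot; have : closure Omega (row_of t) by exact: subset_closure.
  rewrite (mesh_cover hT) => -[alpha _ at_].
  rewrite (energy_density _ _ _ _ _ _ (nbhs_element (pos _ at_))).
  rewrite (bigD1 alpha)//= indicE mem_set// mulr1 big1 ?addr0// => beta ba.
  rewrite indicE memNset ?mulr0// => bt.
  by move: ba; rewrite (element_interior_inj (pos _ at_) bt) eqxx.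
(* A point of an element outside [Omega] is a boundary point of [Omega], hence in [N2]. *)
move=> /negP nOt; rewrite big1// => alpha _; rewrite indicE memNset ?mulr0// => at_.
have : boundary Omega (row_of t).
  split; first exact: (element_closure hT at_).
  by move=> /interior_subset Ot; apply: nOt; rewrite inE.
rewrite bdE => -[a _ ta]; apply: N2t; apply: (HN2 a) => //.
by apply: hull_hyperplane ta => q _; have [_] := Hgb a.
Qed.

End mesh_spring.

Theorem theorem5p2 (R : realType) (d : nat) (hd : d = 2%N \/ d = 3%N)
  (Omega : set 'rV[R]_d) (hOmega : polyhedral_lipschitz_domain Omega)
  (Np Ne : nat) (P : 'I_Np -> 'rV[R]_d) (T : 'I_Ne -> {set 'I_Np})
  (hT : triangulation Omega P T)
  (phi : 'I_Np -> 'rV[R]_d -> R) (hphi : nodal_basis Omega P T phi)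
  (lambda mu : R) (hmu : 0 < mu) (hlambda : 0 < lambda + 2 / d%:R * mu)
  (i j : 'I_Np)
  (hij : j \in spring_neighbours Omega phi (isotropic lambda mu) i)
  (hGamma : ~ ([set P i; P j] `<=` boundary Omega))
  (theta : 'I_Ne -> R)
  (htheta : forall alpha, i \in T alpha -> j \in T alpha ->
     interior_angle (closure (element_face Omega P T phi i j j alpha))
                    (closure (element_face Omega P T phi i j i alpha))
                    (theta alpha)) :
  let nu := lambda / (2 * (lambda + mu)) in
  (forall alpha, i \in T alpha -> j \in T alpha ->
     1 / (3 - 4 * nu) < cos (theta alpha)) ->
  posdefmx (spring Omega phi (isotropic lambda mu) i j).
Proof.
move=> nu hcos xi xi0.
have d1 : (1 < d)%N by case: hd => ->.
have lm0 : 0 < lambda + mu.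
  by move: hlambda; case: hd => ->; lra.
move: hij; rewrite inE => /andP[ji K0].
have ij : i != j by rewrite eq_sym.
have [G [B phiE]] := nodal_affine hphi.
have Gout alpha k : k \notin T alpha -> G alpha k = 0.
  exact: (barycentric_grad_out (mesh_simplex hT alpha)
    (mesh_nondegenerate hT (alpha := alpha))
    (element_barycentric hphi phiE (alpha := alpha))).
(* Nodes lie in the closure of [Omega], and the interior of [Omega] is contained in that of its
   closure; so a node not interior to the closure is on the boundary. *)
have int : interior (closure Omega) (P i) \/ interior (closure Omega) (P j).
  apply: contrapT => /not_orP[ni nj]; apply: hGamma.
  have vert k : closure Omega (P k).
    have [alpha ka] := mesh_node_used hT k.
    by apply: (element_closure hT (alpha := alpha)); exact: hull_vertex.
  by move=> x [] ->; split => // /(interiorS (@subset_closure _ Omega)).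
pose x := xi^T.
have x0 : x != 0 by rewrite trmx_eq0.
pose q alpha := (lambda + mu) * (dot (G alpha j) x * dot (G alpha i) x) +
  mu * dot (G alpha j) (G alpha i) * dot x x.
have -> : \sum_k (spring Omega phi (isotropic lambda mu) i j *m xi) k 0 * xi k 0 =
    - \sum_alpha q alpha * volume P T alpha.
  under [in RHS]eq_bigr do rewrite /q -isotropic_quadratic mulr_suml.
  rewrite exchange_big -sumrN /=; apply: eq_bigr => k _.
  rewrite mxE mulr_suml; under [in RHS]eq_bigr do rewrite mulr_suml.
  rewrite exchange_big -sumrN /=; apply: eq_bigr => l _.
  rewrite (spring_sum hT hphi phiE)// !mulNr !mulr_suml; congr (- _).
  by apply: eq_bigr => alpha _; rewrite !mxE; ring.
have q_lt0 alpha : i \in T alpha -> j \in T alpha -> q alpha < 0.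
  move=> ia ja.
  have bary := element_barycentric hphi phiE (alpha := alpha).
  have Gi0 := grad_neq0 bary ia ja ji; have Gj0 := grad_neq0 bary ja ia ij.
  rewrite /q [X in _ * X]mulrC [dot (G alpha j) (G alpha i)]dotC.
  apply: (isotropic_form_neg hmu lm0 Gi0 Gj0 x0 _ (hcos alpha ia ja)).
  exact: (element_angle_grad hT hphi phiE d1 ia ja ij int (htheta alpha ia ja)).
have q_out alpha : ~~ ((i \in T alpha) && (j \in T alpha)) -> q alpha = 0.
  by rewrite /q negb_and => /orP[]/Gout ->; rewrite ?dot0l ?dot0r; ring.
have term_ge0 alpha : 0 <= - (q alpha * volume P T alpha).
  rewrite -mulNr mulr_ge0 ?volume_ge0// oppr_ge0.
  have [/andP[ia ja]|/q_out ->//] := boolP ((i \in T alpha) && (j \in T alpha)).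
  exact: ltW (q_lt0 _ ia ja).
rewrite -sumrN lt_def sumr_ge0 ?andbT//.
(* If the sum of these nonnegative terms were 0, each element with both vertices would have volume
   0, as [q] is nonzero there. The other elements have a zero gradient, so every entry of the spring
   constant would vanish. *)
apply: contra K0; rewrite psumr_eq0// => /allP all0; apply/eqP/matrixP => k l.
rewrite (spring_sum hT hphi phiE)// big1 ?oppr0 ?mxE// => alpha _.
have [/andP[ia ja]|] := boolP ((i \in T alpha) && (j \in T alpha)).
  have := all0 alpha (mem_index_enum alpha).
  by rewrite /= oppr_eq0 mulf_eq0 lt_eqF ?q_lt0//= => /eqP ->; rewrite mulr0.
by rewrite negb_and => /orP[]/Gout ->; rewrite ?dot0l ?dot0r !mxE; ring.
Qed.
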